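(* The Bost--Connes endomotive is a direct limit of $\Lambda$-rings with compatible integral models.
   Context: $\mathbb{N}$ is the multiplicative semigroup of positive integers. Integral $\Lambda$-ring: a commutative ring $R$ with torsion-free underlying abelian group together with an action of $\mathbb{N}$ by ring endomorphisms $s_k$, $k\in\mathbb{N}$, such that for each prime $p$, $s_p(x)-x^p\in pR$ for all $x\in R$. A morphism of $\Lambda$-rings is a ring homomorphism $f$ with $f\circ s_k=s_k\circ f$ for all $k\in\mathbb{N}$. $\Lambda$-ring over $\mathbb{Q}$: a finite dimensional reduced commutative $\mathbb{Q}$-algebra $A$ with an action of $\mathbb{N}$ by endomorphisms. It has an integral model if $A=R\otimes\mathbb{Q}$ with $R$ an integral $\Lambda$-ring such that the inclusion $R\subset A$ is a morphism of $\Lambda$-rings. A direct limit of $\Lambda$-rings is a direct system of such $\mathbb{Q}$-algebras $A_\alpha$ in which all maps are morphisms of $\Lambda$-rings. The integral models are compatible if they form a direct system under the maps of the system. The Bost--Connes endomotive is given by the abelian algebra $A=\mathbb{Q}[\mathbb{Q}/\mathbb{Z}]=\varinjlim_n A_n$, $A_n=\mathbb{Q}[\mathbb{Z}/n\mathbb{Z}]$ (dual to the inverse system $X_n=\mathrm{Spec}(\mathbb{Q}[t,t^{-1}]/(t^n-1))$ with maps $X_n\to X_m$, $t\mapsto t^{n/m}$ for $m\mid n$), with generators $e(r)$, $r\in\mathbb{Q}/\mathbb{Z}$, and with the semigroup $\mathbb{N}$ acting by the endomorphisms $\sigma_k(e(r))=e(kr)$. Its integral model has abelian part $\mathbb{Z}[\mathbb{Q}/\mathbb{Z}]=\varinjlim_n\mathbb{Z}[\mathbb{Z}/n\mathbb{Z}]$,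 with the same endomorphisms $\sigma_k$. *)

(* Defs.v *)
From HB Require Import structures.
From mathcomp Require Import all_boot all_order all_algebra.
From mathcomp Require Import finmap.
From mathcomp.multinomials Require Import monalg.

Set Implicit Arguments.
Unset Strict Implicit.
Unset Printing Implicit Defensive.

Import GRing.Theory Num.Theory.
Import Quotient.

Local Open Scope ring_scope.


(* The ring structure of {malg R[K]} is only available when K is a monoid
   without nontrivial units, hence not for groups: only the underlying module
   of finitely supported functions G -> R is taken from there. *)
Definition grpring (R : comNzRingType) (G : zmodType) : Type := {malg R[G]}.

HB.instance Definition _ (R : comNzRingType) (G : zmodType) :=
  GRing.Lmodule.copy (grpring R G) {malg R[G]}.

Section GroupRing.
Variables (R : comNzRingType) (G : zmodType).
Implicit Types (x y z : grpring R G) (g h : G) (a b : R).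

Definition gmon a g : grpring R G := << a *g g >>.
Definition gen g : grpring R G := gmon 1 g.

Lemma gmonD g : {morph gmon^~ g : a b / a + b}.
Proof. exact: monalgUD. Qed.

Lemma gmon0 g : gmon 0 g = 0. Proof. exact: monalgU0. Qed.

Lemma gmonZ c a g : c *: gmon a g = gmon (c * a) g.
Proof.
apply/malgP => k; rewrite [LHS]mcoeffZ /gmon !mcoeffU.
by case: eqP; rewrite ?mulr1n ?mulr0n ?mulr0.
Qed.

Lemma grpring_ind (P : grpring R G -> Prop) :
  P 0 -> (forall x y, P x -> P y -> P (x + y)) -> (forall a g, P (gmon a g)) ->
  forall x, P x.
Proof.
move=> P0 PD PU x; rewrite [x]monalgE.
by elim/big_ind: _ => // i _; apply: PU.
Qed.

(* Additive extension to R[G] of a family of additive maps F g : R -> V. *)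
Definition gext (V : zmodType) (F : G -> R -> V) x : V :=
  \sum_(g <- msupp x) F g x@_g.

Section Extension.
Variables (V : zmodType) (F : G -> R -> V).
Hypothesis FD : forall g, {morph F g : a b / a + b}.

Let F0 g : F g 0 = 0.
Proof. by apply: (addrI (F g 0)); rewrite -FD !addr0. Qed.

Lemma gextw (d : {fset G}) x : (msupp x `<=` d)%fset ->
  gext F x = \sum_(g <- d) F g x@_g.
Proof.
by move=> sxd; apply: big_fset_incl => // g _ /mcoeff_outdom ->.
Qed.

Lemma gextD : {morph gext F : x y / x + y}.
Proof.
move=> x y; rewrite (gextw (msuppD_le x y)).
rewrite (gextw (fsubsetUl (msupp x) (msupp y))).
rewrite (gextw (fsubsetUr (msupp x) (msupp y))) -big_split /=.
by apply: eq_bigr => g _; rewrite mcoeffD FD.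
Qed.

Lemma gext0 : gext F 0 = 0.
Proof. by rewrite /gext msupp0 big_seq_fset0. Qed.

Lemma gextU a g : gext F (gmon a g) = F g a.
Proof. by rewrite (gextw (msuppU_le (k := g))) big_seq_fset1 mcoeffUU. Qed.

End Extension.

Definition gmul x y : grpring R G :=
  gext (fun g a => gext (fun h b => gmon (a * b) (g + h)) y) x.

Lemma gmulDr x : {morph gmul x : y z / y + z}.
Proof.
move=> y z; rewrite /gmul [LHS]/gext [X in _ = X + _]/gext [X in _ = _ + X]/gext.
rewrite -big_split /=; apply: eq_bigr => g _.
by rewrite gextD // => h a b; rewrite mulrDr gmonD.
Qed.

Lemma gmulDl y : {morph gmul^~ y : x z / x + z}.
Proof.
move=> x z; rewrite /gmul gextD // => g a b.
rewrite /gext -big_split /=; apply: eq_bigr => h _.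
by rewrite mulrDl gmonD.
Qed.

Lemma gmul0r x : gmul x 0 = 0.
Proof. by apply: (addrI (gmul x 0)); rewrite -gmulDr !addr0. Qed.

Lemma gmul0l y : gmul 0 y = 0.
Proof. exact: gext0. Qed.

Lemma gmulUU a b g h : gmul (gmon a g) (gmon b h) = gmon (a * b) (g + h).
Proof.
rewrite /gmul gextU; last first.
  move=> k c d; rewrite /gext -big_split /=; apply: eq_bigr => l _.
  by rewrite mulrDl gmonD.
by rewrite gextU // => k c d; rewrite mulrDr gmonD.
Qed.

Lemma gmulC : commutative gmul.
Proof.
move=> x y; elim/grpring_ind: x => [|x1 x2 h1 h2|a g].
- by rewrite gmul0l gmul0r.
- by rewrite gmulDl gmulDr h1 h2.
elim/grpring_ind: y => [|y1 y2 h1 h2|b h].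
- by rewrite gmul0l gmul0r.
- by rewrite gmulDl gmulDr h1 h2.
by rewrite !gmulUU mulrC addrC.
Qed.

Lemma gmulA : associative gmul.
Proof.
move=> x y z; elim/grpring_ind: x => [|x1 x2 h1 h2|a g].
- by rewrite !gmul0l.
- by rewrite !gmulDl h1 h2.
elim/grpring_ind: y => [|y1 y2 h1 h2|b h].
- by rewrite gmul0r !gmul0l gmul0r.
- by rewrite gmulDr !gmulDl gmulDr h1 h2.
elim/grpring_ind: z => [|z1 z2 h1 h2|c k].
- by rewrite !gmul0r.
- by rewrite !gmulDr h1 h2.
by rewrite !gmulUU mulrA addrA.
Qed.

Lemma gmul1 : left_id (gen 0) gmul.
Proof.
move=> x; elim/grpring_ind: x => [|x1 x2 h1 h2|a g].
- by rewrite gmul0r.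
- by rewrite gmulDr h1 h2.
by rewrite gmulUU mul1r add0r.
Qed.

Lemma gen_neq0 g : gen g != 0.
Proof.
apply/eqP => /(congr1 (mcoeff g)) /eqP.
by rewrite mcoeffUU mcoeff0 oner_eq0.
Qed.

HB.instance Definition _ := GRing.Zmodule_isComNzRing.Build (grpring R G)
  gmulA gmulC gmul1 (fun x y z => gmulDl z x y) (gen_neq0 0).

Lemma grpringZAl c x y : c *: (x * y) = (c *: x) * y.
Proof.
elim/grpring_ind: x => [|x1 x2 h1 h2|a g].
- by rewrite !(mul0r, scaler0).
- by rewrite !(mulrDl, scalerDr) h1 h2.
elim/grpring_ind: y => [|y1 y2 h1 h2|b h].
- by rewrite !(mulr0, scaler0).
- by rewrite !mulrDr scalerDr h1 h2.
by rewrite gmonZ -![_ * _ : grpring R G]/(gmul _ _) !gmulUU gmonZ mulrA.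
Qed.

HB.instance Definition _ :=
  GRing.LSemiModule_isLSemiAlgebra.Build R (grpring R G) grpringZAl.

Lemma grpringZAr c x y : c *: (x * y) = x * (c *: y).
Proof. by rewrite mulrC grpringZAl mulrC. Qed.

HB.instance Definition _ :=
  GRing.LSemiAlgebra_isSemiAlgebra.Build R (grpring R G) grpringZAr.

End GroupRing.

Arguments gen {R G} g.

(* The ring morphism sum_g a_g [g] |-> sum_g phi(a_g) [f(g)]. *)
Section GroupRingMap.
Variables (R S : comNzRingType) (G H : zmodType).
Variables (phi : {rmorphism R -> S}) (f : {additive G -> H}).

Definition gmap (x : grpring R G) : grpring S H :=
  gext (fun g a => gmon (phi a) (f g)) x.

Let gmap_term g : {morph (fun a => gmon (phi a) (f g)) : a b / a + b}.
Proof. by move=> a b; rewrite rmorphD gmonD. Qed.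

Lemma gmapU a g : gmap (gmon a g) = gmon (phi a) (f g).
Proof. exact: gextU. Qed.

Lemma gmap_is_zmod_morphism : zmod_morphism gmap.
Proof.
have gD : {morph gmap : x y / x + y} by exact: gextD.
by move=> x y; apply/(canRL (addrK _)); rewrite -gD subrK.
Qed.

HB.instance Definition _ := GRing.isZmodMorphism.Build _ _ gmap
  gmap_is_zmod_morphism.

Lemma gmap_is_monoid_morphism : monoid_morphism gmap.
Proof.
split=> [|x y]; first by rewrite [1]/(gmon 1 0) gmapU rmorph1 raddf0.
elim/grpring_ind: x => [|x1 x2 h1 h2|a g].
- by rewrite !(mul0r, raddf0).
- by rewrite mulrDl !raddfD mulrDl /= h1 h2.
elim/grpring_ind: y => [|y1 y2 h1 h2|b h].
- by rewrite !(mulr0, raddf0).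
- by rewrite mulrDr !raddfD mulrDr /= h1 h2.
by rewrite !gmapU -![_ * _]/(gmul _ _) !gmulUU gmapU rmorphM raddfD.
Qed.

HB.instance Definition _ := GRing.isMonoidMorphism.Build _ _ gmap
  gmap_is_monoid_morphism.

Lemma gmap_gen g : gmap (gen g) = gen (f g).
Proof. by rewrite gmapU rmorph1. Qed.

End GroupRingMap.


(* The positive integers are the k : nat with 0 < k; the value of an action
   at 0 is irrelevant.  A ring morphism between Q-algebras is automatically
   Q-linear, so the same notion of morphism serves over Z and over Q. *)

Definition N_action (R : comPzRingType) (s : nat -> {rmorphism R -> R}) : Prop :=
  (forall x, s 1%N x = x) /\
  (forall j k, (0 < j)%N -> (0 < k)%N -> forall x, s (j * k)%N x = s j (s k x)).

Definition Lambda_morphism (R S : comPzRingType) (s : nat -> {rmorphism R -> R})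
    (t : nat -> {rmorphism S -> S}) (f : {rmorphism R -> S}) : Prop :=
  forall k, (0 < k)%N -> forall x, f (s k x) = t k (f x).

Definition torsion_free (V : zmodType) : Prop :=
  forall (n : nat) (x : V), (0 < n)%N -> x *+ n = 0 -> x = 0.

Definition integral_Lambda_ring (R : comPzRingType)
    (s : nat -> {rmorphism R -> R}) : Prop :=
  [/\ torsion_free R, N_action s &
      forall p, prime p -> forall x, exists y, s p x - x ^+ p = p%:R * y].

Definition finite_dimensional (K : fieldType) (V : lmodType K) : Prop :=
  exists (n : nat) (f : {linear V -> 'rV[K]_n}), bijective f.

Definition reduced (R : comPzRingType) : Prop :=
  forall (x : R) (n : nat), x ^+ n = 0 -> x = 0.

Definition Lambda_ring_over_Q (A : comAlgType rat)
    (s : nat -> {rmorphism A -> A}) : Prop :=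
  [/\ finite_dimensional A, reduced A & N_action s].

Definition biadditive (U V W : zmodType) (b : U -> V -> W) : Prop :=
  (forall v, {morph b^~ v : x y / x + y}) /\ (forall u, {morph b u : x y / x + y}).

(* W, with the bilinear map b, is the tensor product of U and V over Z. *)
Definition is_tensor_product (U V W : zmodType) (b : U -> V -> W) : Prop :=
  biadditive b /\
  forall (T : zmodType) (c : U -> V -> T), biadditive c ->
    exists f : {additive W -> T}, (forall u v, f (b u v) = c u v) /\
      forall f' : {additive W -> T}, (forall u v, f' (b u v) = c u v) ->
        forall w, f' w = f w.

Definition integral_model (A : comAlgType rat) (s : nat -> {rmorphism A -> A})
    (R : comPzRingType) (t : nat -> {rmorphism R -> R})
    (iota : {rmorphism R -> A}) : Prop :=
  [/\ integral_Lambda_ring t, injective iota,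
      is_tensor_product (fun (x : R) (q : rat) => q *: iota x)
    & Lambda_morphism t s iota].


Definition directed (I : Type) (le : rel I) : Prop :=
  [/\ inhabited I, reflexive le, transitive le
    & forall i j, exists2 k, le i k & le j k].

Section DirectSystem.
Variables (I : Type) (le : rel I).
Variables (A : I -> comPzRingType) (s : forall i, nat -> {rmorphism A i -> A i}).
Variable f : forall i j, le i j -> {rmorphism A i -> A j}.

Definition direct_system : Prop :=
  [/\ directed le,
      forall i (h : le i i) x, f h x = x,
      forall i j k (hij : le i j) (hjk : le j k) (hik : le i k) x,
        f hjk (f hij x) = f hik x
    & forall i j (h : le i j), Lambda_morphism (s i) (s j) (f h)].

Definition cocone (B : comPzRingType) (t : nat -> {rmorphism B -> B})
    (u : forall i, {rmorphism A i -> B}) : Prop :=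
  [/\ N_action t, forall i, Lambda_morphism (s i) t (u i)
    & forall i j (h : le i j) x, u j (f h x) = u i x].

Definition direct_limit (B : comPzRingType) (t : nat -> {rmorphism B -> B})
    (u : forall i, {rmorphism A i -> B}) : Prop :=
  cocone t u /\
  forall (C : comPzRingType) (r : nat -> {rmorphism C -> C})
    (v : forall i, {rmorphism A i -> C}), cocone r v ->
  exists g : {rmorphism B -> C},
    [/\ Lambda_morphism t r g, forall i x, g (u i x) = v i x
      & forall g' : {rmorphism B -> C}, Lambda_morphism t r g' ->
          (forall i x, g' (u i x) = v i x) -> forall x, g' x = g x].

End DirectSystem.

(* A family of integral models R i of the A i is compatible when the R i form
   a direct system whose maps g are the restrictions of the maps f. *)
Definition compatible_models (I : Type) (le : rel I)
    (A : I -> comPzRingType) (f : forall i j, le i j -> {rmorphism A i -> A j})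
    (R : I -> comPzRingType) (t : forall i, nat -> {rmorphism R i -> R i})
    (g : forall i j, le i j -> {rmorphism R i -> R j})
    (iota : forall i, {rmorphism R i -> A i}) : Prop :=
  direct_system t g /\
  forall i j (h : le i j) x, iota j (g i j h x) = f i j h (iota i x).

Definition direct_limit_of_Lambda_rings_with_compatible_integral_models
    (B : comAlgType rat) (sB : nat -> {rmorphism B -> B})
    (I : Type) (le : rel I)
    (A : I -> comAlgType rat) (s : forall i, nat -> {rmorphism A i -> A i})
    (f : forall i j, le i j -> {rmorphism A i -> A j})
    (u : forall i, {rmorphism A i -> B})
    (R : I -> comPzRingType) (t : forall i, nat -> {rmorphism R i -> R i})
    (g : forall i j, le i j -> {rmorphism R i -> R j})
    (iota : forall i, {rmorphism R i -> A i}) : Prop :=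
  [/\ forall i, Lambda_ring_over_Q (s i),
      @direct_system I le A s f,
      @direct_limit I le A s f B sB u,
      forall i, integral_model (s i) (t i) (iota i)
    & @compatible_models I le A f R t g iota].


Section Multiple.
Variables (G : zmodType) (k : nat).

Definition gmuln (g : G) : G := g *+ k.

Lemma gmuln_is_zmod_morphism : zmod_morphism gmuln.
Proof. by move=> g h; rewrite /gmuln mulrnBl. Qed.

HB.instance Definition _ := GRing.isZmodMorphism.Build G G gmuln
  gmuln_is_zmod_morphism.

End Multiple.

Definition sigma (R : comNzRingType) (G : zmodType) (k : nat) :
    {rmorphism grpring R G -> grpring R G} :=
  gmap (idfun : {rmorphism R -> R}) (gmuln k).

Lemma sigma_gen (R : comNzRingType) (G : zmodType) (k : nat) (r : G) :
  sigma R G k (gen r) = gen (r *+ k).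
Proof. exact: gmap_gen. Qed.

Definition rat_int : {pred rat} := fun q => q \is a Num.int.

Fact rat_int_zmod_closed : zmod_closed rat_int.
Proof. by split=> [|x y xZ yZ]; [exact: int_num0 | exact: (rpredB xZ yZ)]. Qed.

HB.instance Definition _ := GRing.isZmodClosed.Build rat rat_int
  rat_int_zmod_closed.

Definition QmodZ : zmodType := {quot rat_int}.

Definition QmodZ_pi (q : rat) : QmodZ := (\pi_QmodZ q)%qT.

(* The index n : nat stands for the modulus n.+1; 'I_n.+1 carries the additive
   group structure of Z/(n+1)Z, including for n = 0. *)
Definition dvdS : rel nat := fun m n => (m.+1 %| n.+1)%N.

Section CyclicMaps.

(* a mod m+1  |->  a * (n+1)/(m+1) mod n+1 *)
Definition Zmod_incl m n (h : dvdS m n) (a : 'I_m.+1) : 'I_n.+1 :=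
  inZp (a * (n.+1 %/ m.+1)).

Lemma Zmod_incl_is_zmod_morphism m n (h : dvdS m n) : zmod_morphism (Zmod_incl h).
Proof.
have hD : {morph Zmod_incl h : a b / a + b}.
  move=> a b; apply: val_inj; rewrite /= modnDm -mulnDl.
  by have [c nE] := dvdnP h; rewrite nE mulnK // (mulnC c) -!muln_modl modn_mod.
by move=> x y; apply/(canRL (addrK _)); rewrite -hD subrK.
Qed.

HB.instance Definition _ m n (h : dvdS m n) :=
  GRing.isZmodMorphism.Build 'I_m.+1 'I_n.+1 (Zmod_incl h)
    (Zmod_incl_is_zmod_morphism h).

(* a mod n+1  |->  a/(n+1) mod Z *)
Definition Zmod_QmodZ n (a : 'I_n.+1) : QmodZ := QmodZ_pi (a%:R / n.+1%:R).

Lemma Zmod_QmodZ_is_zmod_morphism n : zmod_morphism (@Zmod_QmodZ n).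
Proof.
have hD : {morph @Zmod_QmodZ n : a b / a + b}.
  move=> a b; rewrite /Zmod_QmodZ /QmodZ_pi -raddfD /=; apply/eqP.
  rewrite -idealrBE -mulrDl -mulrBl -natrD [in X in _ - X](divn_eq (a + b) n.+1).
  rewrite [in X in _ - X]natrD natrM opprD addrCA subrr addr0.
  by rewrite mulNr mulfK ?pnatr_eq0 // rpredN rpred_nat.
by move=> x y; apply/(canRL (addrK _)); rewrite -hD subrK.
Qed.

HB.instance Definition _ n := GRing.isZmodMorphism.Build 'I_n.+1 QmodZ
  (@Zmod_QmodZ n) (@Zmod_QmodZ_is_zmod_morphism n).

End CyclicMaps.

Definition BC_alg (R : comNzRingType) (n : nat) : comAlgType R :=
  grpring R 'I_n.+1.

Definition BC_map (R : comNzRingType) (m n : nat) (h : dvdS m n) :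
    {rmorphism BC_alg R m -> BC_alg R n} :=
  gmap (idfun : {rmorphism R -> R}) (Zmod_incl h).

Definition BC_to_limit (R : comNzRingType) (n : nat) :
    {rmorphism BC_alg R n -> grpring R QmodZ} :=
  gmap (idfun : {rmorphism R -> R}) (@Zmod_QmodZ n).

Definition BC_model_incl (n : nat) : {rmorphism BC_alg int n -> BC_alg rat n} :=
  gmap (intr : {rmorphism int -> rat}) (idfun : {additive 'I_n.+1 -> 'I_n.+1}).

(* Main.v *)
Require Import Defs.
From HB Require Import structures.
From mathcomp Require Import all_boot all_order all_algebra.
From mathcomp Require Import finmap.
From mathcomp.multinomials Require Import monalg.

Set Implicit Arguments.
Unset Strict Implicit.
Unset Printing Implicit Defensive.

Import GRing.Theory Num.Theory.
Import Quotient.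

Local Open Scope ring_scope.

(** Additive maps out of a group ring are determined by their values on the
    monomials a[g].  Hence every equality of morphisms in the statement
    (functoriality, commutation with the sigma_k, compatibility of the models
    with the transition maps) is an identity between monomials.  Four facts
    have real content.

    - Q[G] is reduced ([grpring_rat_reduced]).  Let * be the involution
      [g] |-> [-g].  The coefficient of [0] in x x* is the sum of the squares
      of the coefficients of x, so x x* = 0 forces x = 0.  If x^2 = 0, then
      y = x x* is self-adjoint with y y* = y^2 = 0, so y = 0 and x = 0.

    - Z[G] is an integral Lambda-ring ([grpring_int_Lambda_ring]).  Both
      sigma_p and the p-th power are additive modulo p, and on a monomial
      sigma_p (a[g]) - (a[g])^p = (a - a^p)[pg], so the congruence is Fermat's
      little theorem.

    - Q[G] is the tensor product of Z[G] and Q ([grpring_tensor]): a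
      biadditive c on Z[G] x Q factors through q[g] |-> c([g], q), because c
      is balanced over Z ([biadditive_intz]).

    - Q[Q/Z] is the limit of the Q[Z/n] ([BC_direct_limit]), because Q/Z is
      the union of the images of the injections Z/n -> Q/Z
      ([Zmod_QmodZ_inj], [Zmod_QmodZ_surj]).  Given a cocone v, the value on
      a[r] of the induced map is v_n (a[b]) for any b in Z/n with image r.
      By injectivity two such choices agree in a common Z/k, so v gives the
      same value on them ([limit_termE]). *)

(** * Monomials of a group ring *)

Section Basics.
Variables (R : comNzRingType) (G : zmodType).
Implicit Types (x y : grpring R G) (a b : R) (g h : G).

Lemma gmonM a b g h :
  gmon a g * gmon b h = gmon (a * b) (g + h) :> grpring R G.
Proof. exact: gmulUU. Qed.

Lemma gmonX a g n : gmon a g ^+ n = gmon (a ^+ n) (g *+ n) :> grpring R G.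
Proof.
by elim: n => [|n IHn]; rewrite ?expr0 // !exprS IHn gmonM mulrS.
Qed.

Lemma gmonB a b g : gmon (a - b) g = gmon a g - gmon b g.
Proof. exact: monalgUB. Qed.

Lemma grpring_ext (V : zmodType) (u v : {additive grpring R G -> V}) :
  (forall a g, u (gmon a g) = v (gmon a g)) -> u =1 v.
Proof.
move=> uv; elim/grpring_ind => [|x y hx hy|]; rewrite ?raddf0 //.
by rewrite !raddfD hx hy.
Qed.

Lemma gext_is_zmod_morphism (V : zmodType) (F : G -> R -> V) :
  (forall g, {morph F g : a b / a + b}) -> zmod_morphism (gext F).
Proof.
move=> FD; have gD := gextD FD.
by move=> x y; apply/(canRL (addrK _)); rewrite -gD subrK.
Qed.

End Basics.

(** * The rational group ring is reduced *)

Section Reduced.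
Variable G : zmodType.
Implicit Types x y : grpring rat G.

(** The involution sum_g a_g [g] |-> sum_g a_g [-g]. *)
Definition gstar : {rmorphism grpring rat G -> grpring rat G} :=
  gmap (idfun : {rmorphism rat -> rat}) (-%R : {additive G -> G}).

Lemma gstarU a g : gstar (gmon a g) = gmon a (- g).
Proof. exact: gmapU. Qed.

Lemma gstarK : involutive gstar.
Proof.
apply: (@grpring_ext _ _ _ (gstar \o gstar) idfun) => a g /=.
by rewrite !gstarU opprK.
Qed.

(** The coefficient of [0] in x x* is a sum of squares: the bilinear form
    (x, y) |-> (x y* )_0 is positive definite. *)
Lemma gstar_trace x : (x * gstar x)@_0 = \sum_(g <- msupp x) x@_g ^+ 2.
Proof.
have coefMl y a g : (gmon a g * y)@_0 = a * y@_(- g).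
  elim/grpring_ind: y => [|y z hy hz|b h].
  - by rewrite mulr0 !mcoeff0 mulr0.
  - by rewrite mulrDr !mcoeffD hy hz mulrDr.
  rewrite gmonM /gmon !mcoeffU addrC addr_eq0.
  by case: eqP; rewrite ?mulr1n ?mulr0n ?mulr0.
have coef_star y g : (gstar y)@_(- g) = y@_g.
  elim/grpring_ind: y => [|y z hy hz|b h].
  - by rewrite raddf0 !mcoeff0.
  - by rewrite raddfD !mcoeffD hy hz.
  by rewrite gstarU /gmon !mcoeffU eqr_opp.
have -> : x * gstar x = \sum_(g <- msupp x) gmon x@_g g * gstar x.
  by rewrite -mulr_suml; congr (_ * _); rewrite {1}[x]monalgE.
rewrite raddf_sum; apply: eq_bigr => g _ /=.
by rewrite coefMl coef_star expr2.
Qed.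

Lemma gstar_eq0 x : x * gstar x = 0 -> x = 0.
Proof.
move=> /(congr1 (mcoeff 0)); rewrite gstar_trace mcoeff0 => /eqP.
rewrite psumr_eq0 => [|g _]; last exact: sqr_ge0.
move=> /allP sq0; apply/malgP => g; rewrite mcoeff0; apply/eqP.
case: (boolP (g \in msupp x)) => [/sq0|/mcoeff_outdom -> //].
by rewrite /= sqrf_eq0.
Qed.

Lemma grpring_rat_reduced : reduced (grpring rat G).
Proof.
have sqr0 x : x ^+ 2 = 0 -> x = 0.
  move=> x20; apply: gstar_eq0; apply: gstar_eq0.
  by rewrite rmorphM gstarK [gstar x * _]mulrC -expr2 exprMn x20 mul0r.
(* From x^(n+2) = 0 follows (x^(n+1))^2 = 0, so the exponent can be lowered
   down to 1. *)
move=> x n; have [m] := ubnP n; elim: m n => // m IHm [|[|n]] le_nm.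
- by rewrite expr0 => /eqP; rewrite oner_eq0.
- by rewrite expr1.
move=> xn0; apply: (IHm n.+1) => //; apply: sqr0.
by rewrite -exprM muln2 -addnn addSnnS exprD xn0 mulr0.
Qed.

End Reduced.

(** * The action of the positive integers *)

Section Sigma.
Variables (R : comNzRingType).

Lemma sigmaU (G : zmodType) k a (g : G) :
  sigma R G k (gmon a g) = gmon a (g *+ k).
Proof. exact: gmapU. Qed.

Lemma sigma_N_action (G : zmodType) : N_action (sigma R G).
Proof.
split=> [|j k _ _].
  by apply: (@grpring_ext _ _ _ (sigma R G 1) idfun) => a g /=; rewrite sigmaU.
apply: (@grpring_ext _ _ _ (sigma R G _) (sigma R G j \o sigma R G k)) => a g.
by rewrite /= !sigmaU -mulrnA mulnC.
Qed.

Lemma gmap_Lambda_morphism (S : comNzRingType) (G H : zmodType)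
    (phi : {rmorphism R -> S}) (f : {additive G -> H}) :
  Lambda_morphism (sigma R G) (sigma S H) (gmap phi f).
Proof.
move=> k _; set u := gmap phi f.
apply: (@grpring_ext _ _ _ (u \o sigma R G k) (sigma S H k \o u)) => a g /=.
by rewrite !gmapU /= /gmuln raddfMn.
Qed.

End Sigma.

(** * Finite dimension *)

Section FiniteDimension.
Variables (K : fieldType) (n : nat).

(** The coordinates of an element of K[Z/(n+1)] in the basis of the group
    elements. *)
Definition gcoord (x : grpring K 'I_n.+1) : 'rV[K]_n.+1 := \row_i x@_i.

Lemma gcoord_is_linear : linear gcoord.
Proof. by move=> a x y; apply/rowP => i; rewrite !mxE mcoeffD mcoeffZ. Qed.
HB.instance Definition _ := GRing.isLinear.Build K (grpring K 'I_n.+1)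
  'rV[K]_n.+1 _ gcoord gcoord_is_linear.

Lemma grpring_finite_dimensional : finite_dimensional (grpring K 'I_n.+1).
Proof.
exists n.+1, gcoord.
exists (fun v : 'rV_n.+1 => \sum_i gmon (v 0 i) i) => [x|v].
  apply/malgP => i; rewrite raddf_sum (bigD1 i) //= big1 => [|j ji].
    by rewrite mxE mcoeffUU addr0.
  by rewrite mcoeffU (negPf ji).
apply/rowP => i; rewrite mxE raddf_sum (bigD1 i) //= big1 => [|j ji].
  by rewrite mcoeffUU addr0.
by rewrite mcoeffU (negPf ji).
Qed.

End FiniteDimension.

(** * Frobenius congruences *)

Section Frobenius.

(** The p-th power map is additive modulo p. *)
Lemma Frobenius_add (R : comPzRingType) p (x y : R) : prime p ->
  exists z, (x + y) ^+ p = x ^+ p + y ^+ p + p%:R * z.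
Proof.
case: p => // p p_pr.
exists (\sum_(i < p) (x ^+ (p - i) * y ^+ i.+1) *+ ('C(p.+1, i.+1) %/ p.+1)).
rewrite exprDn big_ord_recl big_ord_recr /= !subn0 bin0 binn subnn !mulr1n.
rewrite mulr1 mul1r -addrA [X in _ + X = _]addrC; congr (_ + (_ + _)).
rewrite mulr_sumr; apply: eq_bigr => i _; rewrite /bump leq0n add1n subSS.
by rewrite mulr_natl -mulrnA divnK // prime_dvd_bin //= ltnS.
Qed.

Lemma Fermat_int p (a : int) : prime p -> exists c, a - a ^+ p = p%:R * c.
Proof.
move=> p_pr; suff /dvdzP[c ->]: (p%:Z %| a - a ^+ p)%Z.
  by exists c; rewrite mulrC natz.
have nat_case (n : nat) : (p%:Z %| n%:Z - n%:Z ^+ p)%Z.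
  rewrite -eqz_mod_dvd -rmorphXn /= !modz_nat.
  by rewrite [X in _ == X]/= eqz_nat fermat_little.
case: (intP a) => [|n|n] //; first exact: (nat_case 0%N).
have [p2|p_odd] := even_prime p_pr.
  (* For p = 2 the sign is absorbed by a + a^2 = 2a - (a - a^2). *)
  rewrite p2 sqrrN -opprD rpredN.
  have -> : n.+1%:Z + n.+1%:Z ^+ 2 = n.+1%:Z *+ 2 - (n.+1%:Z - n.+1%:Z ^+ 2).
    by rewrite opprB [RHS]addrC mulr2n addrA subrK addrC.
  rewrite rpredB //; last by rewrite -p2.
  by rewrite -mulr_natr dvdz_mull.
rewrite exprNn -signr_odd p_odd expr1 mulN1r -opprD rpredN.
exact: nat_case.
Qed.

Lemma grpring_int_Frobenius (G : zmodType) p (x : grpring int G) :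
  prime p -> exists y, sigma int G p x - x ^+ p = p%:R * y.
Proof.
move=> p_pr; elim/grpring_ind: x => [|x y [u hu] [v hv]|a g].
- by exists 0; rewrite raddf0 expr0n (gtn_eqF (prime_gt0 p_pr)) subrr mulr0.
- have [z ->] := Frobenius_add x y p_pr; exists (u + v - z).
  by rewrite raddfD mulrBr mulrDr -hu -hv opprD addrA opprD addrACA.
have [c hc] := Fermat_int a p_pr.
exists (gmon c (g *+ p)); rewrite sigmaU gmonX -gmonB hc.
by rewrite [p%:R * c]mulr_natl [RHS]mulr_natl /gmon monalgUMn.
Qed.

End Frobenius.

(** * The integral model Z[G] of Q[G] *)

Section IntegralModel.
Variable G : zmodType.

(** The inclusion of Z[G] into Q[G]. *)
Definition ginclQ : {rmorphism grpring int G -> grpring rat G} :=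
  gmap (intr : {rmorphism int -> rat}) (idfun : {additive G -> G}).

Lemma ginclQU a (g : G) : ginclQ (gmon a g) = gmon a%:~R g.
Proof. exact: gmapU. Qed.

Lemma mcoeff_ginclQ (x : grpring int G) g : (ginclQ x)@_g = (x@_g)%:~R.
Proof.
elim/grpring_ind: x => [|x y hx hy|a h].
- by rewrite raddf0 !mcoeff0.
- by rewrite raddfD !mcoeffD hx hy rmorphD.
by rewrite ginclQU /gmon !mcoeffU rmorphMn.
Qed.

Lemma ginclQ_inj : injective ginclQ.
Proof.
move=> x y exy; apply/malgP => g; apply: (@intr_inj rat).
by rewrite -!mcoeff_ginclQ exy.
Qed.

Lemma grpring_int_torsion_free : torsion_free (grpring int G).
Proof.
move=> n x n_gt0 xn0; apply/malgP => g; rewrite mcoeff0; apply/eqP.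
have /eqP := congr1 (mcoeff g) xn0.
by rewrite mcoeffMn mcoeff0 mulrn_eq0 (gtn_eqF n_gt0).
Qed.

Lemma grpring_int_Lambda_ring : integral_Lambda_ring (sigma int G).
Proof.
split; [exact: grpring_int_torsion_free | exact: sigma_N_action |].
by move=> p p_pr x; apply: grpring_int_Frobenius.
Qed.

Section BiadditiveInt.
Variables (U V W : zmodType) (b : U -> V -> W).
Hypothesis bilb : biadditive b.

(** A biadditive map is balanced over Z. *)
Lemma biadditive_intz u v (m : int) : b (u *~ m) v = b u (v *~ m).
Proof.
have [bl br] := bilb.
have bl0 w : b 0 w = 0 by apply: (addrI (b 0 w)); rewrite -bl !addr0.
have br0 w : b w 0 = 0 by apply: (addrI (b w 0)); rewrite -br !addr0.
have blN u' w : b (- u') w = - b u' w.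
  by apply: (addrI (b u' w)); rewrite -bl !subrr bl0.
have brN u' w : b u' (- w) = - b u' w.
  by apply: (addrI (b u' w)); rewrite -br !subrr br0.
have nat_case (n : nat) : b (u *+ n) v = b u (v *+ n).
  by elim: n => [|n IHn]; rewrite ?mulr0n ?bl0 ?br0 // !mulrS bl br IHn.
by case: m => n; rewrite ?NegzE ?mulrNz ?blN ?brN -!pmulrn nat_case.
Qed.

End BiadditiveInt.

Lemma grpring_tensor :
  is_tensor_product (fun (x : grpring int G) (q : rat) => q *: ginclQ x).
Proof.
split.
  by split=> [q x y|x p q]; rewrite ?raddfD ?scalerDr ?scalerDl.
move=> T c c_bil; have [cl cr] := c_bil.
pose F (g : G) q := c (gen g) q.
have FD g : {morph F g : p q / p + q} by move=> p q; apply: cr.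
pose f : {additive grpring rat G -> T} :=
  HB.pack (gext F) (GRing.isZmodMorphism.Build _ _ _ (gext_is_zmod_morphism FD)).
have fU q g : f (gmon q g) = c (gen g) q by rewrite /f /= gextU.
exists f; split=> [x q|f' f'c].
  elim/grpring_ind: x => [|x y hx hy|a g].
  - rewrite raddf0 scaler0 raddf0; apply: (addrI (c 0 q)).
    by rewrite -cl !addr0.
  - by rewrite raddfD scalerDr raddfD hx hy cl.
  rewrite ginclQU gmonZ fU mulrzr -(biadditive_intz c_bil); congr (c _ q).
  by rewrite -scaler_int gmonZ mulr1 intz.
apply: grpring_ext => q g; rewrite fU -f'c ginclQU gmonZ; congr (f' (gmon _ _)).
by rewrite rmorph1 mulr1.
Qed.

Lemma grpring_integral_model :
  integral_model (sigma rat G) (sigma int G) ginclQ.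
Proof.
split; [exact: grpring_int_Lambda_ring | exact: ginclQ_inj | |].
- exact: grpring_tensor.
- exact: gmap_Lambda_morphism.
Qed.

End IntegralModel.

(** * Q/Z as the union of the groups Z/n *)

Section CyclicGroups.

Lemma dvdS_directed : directed dvdS.
Proof.
split; [by constructor; exact: 0%N | by move=> n; apply: dvdnn | |].
  by move=> n m k; apply: dvdn_trans.
move=> m n; have l_gt0 : (0 < lcmn m.+1 n.+1)%N by rewrite lcmn_gt0.
by exists (lcmn m.+1 n.+1).-1; rewrite /dvdS prednK ?dvdn_lcml ?dvdn_lcmr.
Qed.

Lemma Zmod_incl_id n (h : dvdS n n) : Zmod_incl h =1 id.
Proof.
by move=> a; apply: val_inj; rewrite /= divnn muln1 modn_small.
Qed.

Lemma Zmod_QmodZ_eq m n (a : 'I_m.+1) (b : 'I_n.+1) :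
  reflect (exists z : int, a%:R / m.+1%:R - b%:R / n.+1%:R = z%:~R :> rat)
    (Zmod_QmodZ a == Zmod_QmodZ b).
Proof.
rewrite /Zmod_QmodZ /QmodZ_pi -idealrBE.
by apply: (iffP intrP) => -[z hz]; exists z.
Qed.

Lemma Zmod_QmodZ_inj n : injective (@Zmod_QmodZ n).
Proof.
move=> a b /eqP/Zmod_QmodZ_eq[z].
have n_neq0 : n.+1%:R != 0 :> rat by rewrite pnatr_eq0.
rewrite -mulrBl => /(canRL (divfK n_neq0)).
move=> ez; have {}ez : a%:Z - b%:Z = z * n.+1%:Z.
  by apply: (@intr_inj rat); rewrite rmorphB rmorphM /= -!pmulrn.
have : (a%:Z == b%:Z %[mod n.+1%:Z])%Z by rewrite eqz_mod_dvd ez dvdz_mull.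
by rewrite !modz_nat eqz_nat !modn_small // => /eqP; apply: val_inj.
Qed.

Lemma Zmod_QmodZ_incl m n (h : dvdS m n) (a : 'I_m.+1) :
  Zmod_QmodZ (Zmod_incl h a) = Zmod_QmodZ a.
Proof.
apply/eqP/Zmod_QmodZ_eq; have [c nE] := dvdnP h.
have c_gt0 : (0 < c)%N by case: c nE.
rewrite /Zmod_incl /=; have -> : (n.+1 %/ m.+1 = c)%N by rewrite nE mulnK.
(* The numerator a * c is reduced modulo n+1; the quotient of that division is
   the integer by which the two fractions differ. *)
exists (- ((a * c) %/ n.+1)%N%:Z).
have /(congr1 (fun k => k%:R : rat)) := divn_eq (a * c) n.+1.
rewrite natrD [X in _ = X + _]natrM => /(canLR (addKr _)) <-.
have ac_div : (a * c)%N%:R / n.+1%:R = a%:R / m.+1%:R :> rat.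
  rewrite nE !natrM [a%:R * _]mulrC -mulf_div divff ?mul1r //.
  by rewrite pnatr_eq0 -lt0n.
by rewrite mulrDl mulNr mulfK ?pnatr_eq0 // ac_div addrK rmorphN.
Qed.

Lemma Zmod_incl_comp i j k (hij : dvdS i j) (hjk : dvdS j k) (hik : dvdS i k) a :
  Zmod_incl hjk (Zmod_incl hij a) = Zmod_incl hik a.
Proof. by apply: Zmod_QmodZ_inj; rewrite !Zmod_QmodZ_incl. Qed.

(** Every element of Q/Z comes from some Z/n.  The witnesses range over a
    choice type and the equality is boolean, so that a preimage can be
    selected. *)
Lemma Zmod_QmodZ_surj (r : QmodZ) :
  exists w : {n : nat & 'I_n.+1}, Zmod_QmodZ (tagged w) == r.
Proof.
(* The class of q = u/d is the image of u mod d in Z/d. *)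
pose q := repr r; pose n := `|denq q|.-1.
have nE : n.+1%:Z = denq q.
  by rewrite prednK ?absz_gt0 ?denq_neq0 // gez0_abs // denq_ge0.
have an : (`|(numq q %% denq q)%Z| < n.+1)%N.
  by rewrite -ltz_nat nE gez0_abs ?modz_ge0 ?denq_neq0 // ltz_pmod.
exists (Tagged (fun n => 'I_n.+1) (Ordinal an)) => /=.
rewrite /Zmod_QmodZ -[r in _ == r]reprK -/q /QmodZ_pi -idealrBE; apply/intrP.
exists (- (numq q %/ denq q)%Z).
have numE : `|(numq q %% denq q)%Z|%N%:R = (numq q %% denq q)%Z%:~R :> rat.
  by rewrite pmulrn gez0_abs ?modz_ge0 ?denq_neq0.
rewrite /= numE [n.+1%:R]pmulrn nE -[X in _ - X]divq_num_den -mulrBl.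
rewrite -rmorphB /= [X in _ - X](divz_eq (numq q) (denq q)).
rewrite opprD addrCA subrr addr0.
by rewrite rmorphN rmorphM mulNr mulfK ?intr_eq0 ?denq_neq0 ?rmorphN.
Qed.

Lemma QmodZ_common_level (p q : QmodZ) :
  exists n (b c : 'I_n.+1), p = Zmod_QmodZ b /\ q = Zmod_QmodZ c.
Proof.
have [[m b] /= /eqP <-] := Zmod_QmodZ_surj p.
have [[n c] /= /eqP <-] := Zmod_QmodZ_surj q.
have [_ _ _ dirS] := dvdS_directed; have [k mk nk] := dirS m n.
by exists k, (Zmod_incl mk b), (Zmod_incl nk c); rewrite !Zmod_QmodZ_incl.
Qed.

End CyclicGroups.

(** * The direct limit *)

Section Limit.
Variable R : comNzRingType.

Lemma BC_mapU m n (h : dvdS m n) a (b : 'I_m.+1) :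
  BC_map R h (gmon a b) = gmon a (Zmod_incl h b).
Proof. exact: gmapU. Qed.

Lemma BC_to_limitU n a (b : 'I_n.+1) :
  BC_to_limit R n (gmon a b) = gmon a (Zmod_QmodZ b).
Proof. exact: gmapU. Qed.

Lemma BC_direct_system :
  direct_system (fun n => sigma R 'I_n.+1) (BC_map R).
Proof.
split; first exact: dvdS_directed.
- move=> i h; apply: (@grpring_ext _ _ _ (BC_map R h) idfun) => a b /=.
  by rewrite BC_mapU Zmod_incl_id.
- move=> i j k hij hjk hik.
  apply: (@grpring_ext _ _ _ (BC_map R hjk \o BC_map R hij) (BC_map R hik)).
  by move=> a b; rewrite /= !gmapU /= Zmod_incl_comp.
- by move=> i j h; apply: gmap_Lambda_morphism.
Qed.

Lemma BC_cocone :
  cocone (fun n => sigma R 'I_n.+1) (BC_map R) (sigma R QmodZ) (BC_to_limit R).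
Proof.
split; first exact: sigma_N_action.
- by move=> i; apply: gmap_Lambda_morphism.
- move=> i j h.
  apply: (@grpring_ext _ _ _ (BC_to_limit R j \o BC_map R h) (BC_to_limit R i)).
  by move=> a b; rewrite /= !gmapU /= Zmod_QmodZ_incl.
Qed.

Section Universal.
Variables (C : comPzRingType) (r : nat -> {rmorphism C -> C}).
Variable v : forall n, {rmorphism BC_alg R n -> C}.
Hypothesis v_cocone : cocone (fun n => sigma R 'I_n.+1) (BC_map R) r v.

(** The image v_n (a[b]) of the monomial a[q], for a selected preimage b of q in
    some Z/n. *)
Definition limit_term (q : QmodZ) (a : R) : C :=
  let w := xchoose (Zmod_QmodZ_surj q) in v (tag w) (gmon a (tagged w)).

(** The value does not depend on the preimage. *)
Lemma limit_termE n (b : 'I_n.+1) a : limit_term (Zmod_QmodZ b) a = v n (gmon a b).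
Proof.
have [_ _ v_comp] := v_cocone; rewrite /limit_term.
case: (xchoose _) (xchooseP (Zmod_QmodZ_surj (Zmod_QmodZ b))) => m c /= /eqP cb.
have [_ _ _ dirS] := dvdS_directed; have [k mk nk] := dirS m n.
rewrite -(v_comp m k mk) -(v_comp n k nk) !BC_mapU; congr (v k (gmon a _)).
by apply: Zmod_QmodZ_inj; rewrite !Zmod_QmodZ_incl.
Qed.

Lemma limit_termD q : {morph limit_term q : a b / a + b}.
Proof. by move=> a b; rewrite /limit_term gmonD raddfD. Qed.

(** The map from R[Q/Z] induced by the cocone v. *)
Definition limit_map : grpring R QmodZ -> C := gext limit_term.

HB.instance Definition _ := GRing.isZmodMorphism.Build _ _ limit_map
  (gext_is_zmod_morphism limit_termD).

Lemma limit_mapU n (b : 'I_n.+1) a :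
  limit_map (gmon a (Zmod_QmodZ b)) = v n (gmon a b).
Proof. by rewrite /limit_map (gextU limit_termD) limit_termE. Qed.

Lemma limit_map_is_monoid_morphism : monoid_morphism limit_map.
Proof.
split=> [|x y].
  have -> : 1 = gmon 1 (Zmod_QmodZ (0 : 'I_1)) :> grpring R QmodZ.
    by rewrite raddf0.
  by rewrite limit_mapU; apply: (rmorph1 (v 0%N)).
have mapD : {morph limit_map : x y / x + y} := gextD limit_termD.
elim/grpring_ind: x => [|x1 x2 h1 h2|a p].
- by rewrite !(mul0r, raddf0).
- by rewrite mulrDl !mapD [X in X + _ = _]h1 [X in _ + X = _]h2 mulrDl.
elim/grpring_ind: y => [|y1 y2 h1 h2|b q].
- by rewrite !(mulr0, raddf0).
- by rewrite mulrDr !mapD [X in X + _ = _]h1 [X in _ + X = _]h2 mulrDr.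
have [n [c [d [-> ->]]]] := QmodZ_common_level p q.
by rewrite gmonM -raddfD !limit_mapU -rmorphM gmonM.
Qed.

HB.instance Definition _ := GRing.isMonoidMorphism.Build _ _ limit_map
  limit_map_is_monoid_morphism.

Definition limit_morphism : {rmorphism grpring R QmodZ -> C} := limit_map.

End Universal.

Lemma BC_direct_limit :
  direct_limit (fun n => sigma R 'I_n.+1) (BC_map R) (sigma R QmodZ)
    (BC_to_limit R).
Proof.
split=> [|C r v v_cocone]; first exact: BC_cocone.
pose g := limit_morphism v_cocone.
have gU n (b : 'I_n.+1) a : g (gmon a (Zmod_QmodZ b)) = v n (gmon a b).
  exact: (limit_mapU v_cocone).
have [_ v_Lambda _] := v_cocone.
exists g; split=> [k k_gt0|n|g' _ g'v].
- apply: (@grpring_ext _ _ _ (g \o sigma R QmodZ k) (r k \o g)) => a q.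
  have [[n b] /= /eqP <-] := Zmod_QmodZ_surj q.
  by rewrite sigmaU -raddfMn !gU -v_Lambda // sigmaU.
- apply: (@grpring_ext _ _ _ (g \o BC_to_limit R n) (v n)) => a b.
  by rewrite [LHS]/= gmapU gU.
apply: grpring_ext => a q.
have [[n b] /= /eqP <-] := Zmod_QmodZ_surj q.
by rewrite gU -g'v BC_to_limitU.
Qed.

End Limit.

Theorem lemma4p5 :
  @direct_limit_of_Lambda_rings_with_compatible_integral_models
    (grpring rat QmodZ) (sigma rat QmodZ)
    nat dvdS
    (BC_alg rat) (fun n : nat => sigma rat 'I_n.+1)
    (BC_map rat) (BC_to_limit rat)
    (BC_alg int) (fun n : nat => sigma int 'I_n.+1)
    (BC_map int) BC_model_incl.
Proof.
split.
- move=> n; split; [exact: grpring_finite_dimensional| |exact: sigma_N_action].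
  exact: grpring_rat_reduced.
- exact: BC_direct_system.
- exact: BC_direct_limit.
- by move=> n; apply: grpring_integral_model.
split=> [|i j h]; first exact: BC_direct_system.
apply: (@grpring_ext _ _ _ (BC_model_incl j \o BC_map int h)
                           (BC_map rat h \o BC_model_incl i)) => a b.
by rewrite /= !gmapU.
Qed.
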